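(* Let $M$ be an ACI-matrix over a field $\mathbb{F}$. Then there exist a nonsingular constant matrix $R$ and a permutation matrix $Q$ such that $$RMQ=\begin{bmatrix} \mathbf{W} & * & *\\ 0 & \mathbf{S} & *\\ 0 & 0 & \mathbf{T}\end{bmatrix},$$ where $\mathbf{W}$ is a wide FmR ACI-matrix or void, $\mathbf{S}$ is a square FmR ACI-matrix or void, and $\mathbf{T}$ is a tall FmR ACI-matrix or void (the entries marked $*$ are unrestricted blocks). Moreover, if $\mathbf{S}$ is required to be as large as possible among all such decompositions of $M$, then $\mathbf{W}$, $\mathbf{S}$ and $\mathbf{T}$ are unique up to equivalence.
   Context: Let $\mathbb{F}$ be a field. An ACI-matrix is a matrix with entries in $\mathbb{F}[x_1,\dots,x_k]$ whose entries are polynomials of degree at most one and such that no indeterminate appears in two different columns. A completion is an assignment of values in $\mathbb{F}$ to all indeterminates; $\mathrm{maxRank}(N)$ is the maximum rank of a completion. Two ACI-matrices satisfy $N\sim N'$ (equivalent) if $N'=RNQ$ with $R$ a nonsingular constant matrix over $\mathbb{F}$ and $Q$ a permutation matrix. $N$ is wide if it has more columns than rows, tall if more rows than columns, square if equal. ACI-matrices (and blocks) of size $0\times q$ ($q>0$, wide degenerate, counted as wide), $p\times 0$ ($p>0$, tall degenerate, counted as tall) and $0\times0$ (void) are allowed. $N$ is FmR if $\mathrm{maxRank}(N)=\min\{\mathrm{rows}(N),\mathrm{cols}(N)\}$ (so degenerate ACI-matrices are FmR). *)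

(* Defs.v *)
From HB Require Import structures.
From mathcomp Require Import all_boot all_order all_fingroup all_algebra.
Set Implicit Arguments. Unset Strict Implicit. Unset Printing Implicit Defensive.
Import GRing.Theory.
Local Open Scope ring_scope.

(* An m x n matrix over F[x_1,...,x_k] whose entries have degree <= 1 is
   represented by its constant part [aci_cst] and, for each indeterminate
   x_l (l : 'I_k), the matrix [aci_coef l] of coefficients of x_l:
   entry (i,j) is  aci_cst i j + \sum_l aci_coef l i j * x_l. *)
Record aci (F : fieldType) (k m n : nat) := ACI {
  aci_cst : 'M[F]_(m, n);
  aci_coef : 'I_k -> 'M[F]_(m, n) }.

Definition isACI (F : fieldType) k m n (N : aci F k m n) : Prop :=
  forall (l : 'I_k) (i1 i2 : 'I_m) (j1 j2 : 'I_n),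
    aci_coef N l i1 j1 != 0 -> aci_coef N l i2 j2 != 0 -> j1 = j2.

Definition completion (F : fieldType) k m n (N : aci F k m n) (x : 'I_k -> F)
  : 'M[F]_(m, n) := aci_cst N + \sum_(l < k) x l *: aci_coef N l.

Definition is_maxRank (F : fieldType) k m n (N : aci F k m n) (r : nat) : Prop :=
  (exists x, \rank (completion N x) = r) /\ (forall x, (\rank (completion N x) <= r)%N).

Definition FmR (F : fieldType) k m n (N : aci F k m n) : Prop :=
  is_maxRank N (minn m n).

(* Applying a map entrywise-linear in the matrix (products with constant
   matrices, casts, block extraction) to an ACI-matrix. *)
Definition aci_map (F : fieldType) k m n m' n'
  (f : 'M[F]_(m, n) -> 'M[F]_(m', n')) (N : aci F k m n) : aci F k m' n' :=
  ACI (f (aci_cst N)) (fun l => f (aci_coef N l)).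

Definition aci_zero (F : fieldType) k m n (N : aci F k m n) : Prop :=
  aci_cst N = 0 /\ forall l, aci_coef N l = 0.

Definition aci_equiv (F : fieldType) k m n m' n' (N : aci F k m n) (N' : aci F k m' n')
  : Prop :=
  exists (em : m = m') (en : n = n') (R : 'M[F]_m') (s : 'S_n'),
    R \in unitmx /\
    N' = aci_map (fun A => R *m A *m perm_mx s) (aci_map (castmx (em, en)) N).

(* wide (incl. 0 x q, q > 0) or void; square or void; tall (incl. p x 0) or void *)
Definition wide_or_void (p q : nat) : Prop := (p < q)%N \/ (p = 0 /\ q = 0)%N.
Definition square_or_void (p q : nat) : Prop := p = q.
Definition tall_or_void (p q : nat) : Prop := (q < p)%N \/ (p = 0 /\ q = 0)%N.

Definition WST_decomp (F : fieldType) k m n (M : aci F k m n)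
  (p1 p2 p3 q1 q2 q3 : nat)
  (W : aci F k p1 q1) (S : aci F k p2 q2) (T : aci F k p3 q3) : Prop :=
  exists (em : m = (p1 + (p2 + p3))%N) (en : n = (q1 + (q2 + q3))%N)
         (R : 'M[F]_m) (s : 'S_n),
    R \in unitmx /\
    let B := aci_map (castmx (em, en))
               (aci_map (fun A => R *m A *m perm_mx s) M) in
    [/\ aci_zero (aci_map dlsubmx B),
        aci_zero (aci_map dlsubmx (aci_map drsubmx B)),
        W = aci_map ulsubmx B,
        S = aci_map ulsubmx (aci_map drsubmx B) &
        T = aci_map drsubmx (aci_map drsubmx B)] /\
    [/\ wide_or_void p1 q1, isACI W & FmR W] /\
    [/\ square_or_void p2 q2, isACI S & FmR S] /\
    [/\ tall_or_void p3 q3, isACI T & FmR T].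

Definition maxS_decomp (F : fieldType) k m n (M : aci F k m n)
  (p1 p2 p3 q1 q2 q3 : nat)
  (W : aci F k p1 q1) (S : aci F k p2 q2) (T : aci F k p3 q3) : Prop :=
  WST_decomp M W S T /\
  forall p1' p2' p3' q1' q2' q3' (W' : aci F k p1' q1') (S' : aci F k p2' q2')
         (T' : aci F k p3' q3'),
    WST_decomp M W' S' T' -> (p2' <= p2)%N.

(* Main.v *)
(* Since no indeterminate occurs in two columns, a completion picks,
   independently for each j, a point of an affine space whose linear span is
   V_j.  Put h(J) = dim (\sum_(j in J) V_j) + #|~: J|.  Every completion has
   rank at most h(J), and Rado's theorem on independent transversals shows that
   maxRank = min_J h(J).  As h is submodular, its minimizers have a smallest
   element J1 and a largest element J2; the columns J1, J2 \ J1, ~J2 and the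
   flag \sum_(J1) V_j <= \sum_(J2) V_j give a decomposition.  Conversely, the
   columns of W and those of W and S of any decomposition are minimizers
   I1 <= I2 with #|I2 \ I1| the size of S, so S is largest only for
   (I1, I2) = (J1, J2); two such decompositions then differ by a
   block-triangular change of basis. *)
Require Import Defs.
From HB Require Import structures.
From mathcomp Require Import all_boot all_order all_fingroup all_algebra.
From mathcomp Require Import zify.
From Stdlib Require Import FunctionalExtensionality.
Set Implicit Arguments. Unset Strict Implicit. Unset Printing Implicit Defensive.
Import GRing.Theory.
Local Open Scope ring_scope.

(** * Rado's theorem on independent transversals *)

(** Modularity of dimension, in the weakened form that serves both submodularity arguments below. *)
Lemma rank_sub_cap_sum (F : fieldType) m (P Q A B : 'M[F]_m) :
  (A <= P + Q)%MS -> (B <= P :&: Q)%MS ->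
  (\rank A + \rank B <= \rank P + \rank Q)%N.
Proof.
by move=> /mxrankS hA /mxrankS hB; rewrite -(mxrank_sum_cap P Q) leq_add.
Qed.

(* As long as some X j has two elements, one of them can be deleted: if both
   deletions violated the hypothesis, at J1 and J2, then submodularity of the
   rank would violate it for X at J1 :|: J2 or at (J1 :&: J2) :\ j. *)
Lemma rado (F : fieldType) (T I : finType) (i0 : I) m (v : T -> I -> 'rV[F]_m)
    (r : nat) (X : {ffun T -> {set I}}) :
  (forall J : {set T},
     (r <= \rank (\sum_(j in J) \sum_(i in X j) <<v j i>>)%MS + #|~: J|)%N) ->
  exists phi : T -> I, (r <= \rank (\sum_j <<v j (phi j)>>)%MS)%N.
Proof.
pose sp (X : {ffun T -> {set I}}) (J : {set T}) : 'M[F]_m :=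
  (\sum_(j in J) \sum_(i in X j) <<v j i>>)%MS.
rewrite -/(sp X _).
have sp_in (Y : {ffun T -> {set I}}) (J : {set T}) j i :
    j \in J -> i \in Y j -> (<<v j i>> <= sp Y J)%MS.
  move=> jJ iY; apply: (sumsmx_sup j) => //; exact: (sumsmx_sup i).
have sp_sub (Y : {ffun T -> {set I}}) (J : {set T}) (A : 'M[F]_m) :
    (forall j i, j \in J -> i \in Y j -> (<<v j i>> <= A)%MS) -> (sp Y J <= A)%MS.
  by move=> h; apply/sumsmx_subP => j jJ; apply/sumsmx_subP => i iY; apply: h.
have [s] := ubnP (\sum_j #|X j|); elim: s X => // s IH X sX hX.
have [/existsP [j /card_gt1P [x1 [x2 [x1X x2X x12]]]] | small] :=
  boolP [exists j, (1 < #|X j|)%N]; last first.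
  (* Every [X j] has at most one element, and the hypothesis at [setT] is the claim. The default
     [i0] is chosen only where [X j] is empty, so where nothing has to be covered. *)
  exists (fun j => odflt i0 [pick i in X j]).
  have := hX setT; rewrite setCT cards0 addn0 => /leq_trans; apply.
  apply/mxrankS/sp_sub => j i _ iX.
  apply: (sumsmx_sup j) => //=; case: pickP => [i' i'X|/(_ i)]; last by rewrite iX.
  rewrite /= (_ : i = i') //.
  move: small; rewrite negb_exists => /forallP /(_ j); rewrite -leqNgt.
  by move/card_le1_eqP; apply.
pose del x := [ffun j' => if j' == j then X j :\ x else X j'] : {ffun T -> {set I}}.
have del_sub x j' : del x j' \subset X j'.
  by rewrite ffunE; case: eqP => [->|_] //; exact: subsetDl.
have del_small x : x \in X j -> (\sum_j #|del x j| < s)%N.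
  move=> xX; rewrite -ltnS; apply: leq_trans sX; rewrite ltnS.
  rewrite (bigD1 j) //= [X in (_ < X)%N](bigD1 j) //= ffunE eqxx.
  rewrite (cardsD1 x (X j)) xX add1n addSn ltnS leq_add2l.
  by apply: leq_sum => i _; apply/subset_leq_card/del_sub.
have [/forallP h1|/forallPn [J1 h1]] :=
    boolP [forall J : {set T}, r <= \rank (sp (del x1) J) + #|~: J|]%N.
  by apply: IH h1; apply: del_small.
have [/forallP h2|/forallPn [J2 h2]] :=
    boolP [forall J : {set T}, r <= \rank (sp (del x2) J) + #|~: J|]%N.
  by apply: IH h2; apply: del_small.
(* A deletion leaves the span over [J] unchanged unless [j] lies in [J], so both violating sets
   contain [j]. *)
have del_out x (J : {set T}) : j \notin J -> (sp X J <= sp (del x) J)%MS.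
  move=> jJ; apply: sp_sub => j' i j'J iX; apply: sp_in => //.
  by rewrite ffunE; case: eqP => // e; rewrite -e j'J in jJ.
have jJ x (J : {set T}) : ~~ (r <= \rank (sp (del x) J) + #|~: J|)%N -> j \in J.
  apply: contraR => /(del_out x) /mxrankS hr; apply: leq_trans (hX J) _.
  by rewrite leq_add2r.
have hX' (J : {set T}) : (r <= \rank (sp X J) + #|~: J|)%N by apply: hX.
have := hX' (J1 :|: J2); have := hX' ((J1 :&: J2) :\ j).
have jJ1 := jJ _ _ h1; have jJ2 := jJ _ _ h2.
(* Both violations are strict, so the right-hand side plus [#|~: J1| + #|~: J2|] is at most 2r - 2.
   Dropping [j] from the intersection raises the total size of the complements by only one, whereas
   [hX'] at the two new sets demands 2r. *)
have : (\rank (sp X (J1 :|: J2)) + \rank (sp X ((J1 :&: J2) :\ j)) <=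
        \rank (sp (del x1) J1) + \rank (sp (del x2) J2))%N.
  apply: rank_sub_cap_sum.
    apply: sp_sub => j' i j'J iX.
    have [e|ne] := eqVneq j' j.
      (* The element [x1] missing over [J1] is still present over [J2], where only [x2] was
         deleted. *)
      rewrite {}e in j'J iX *; have [->|ix1] := eqVneq i x1.
        apply: submx_trans (addsmxSr _ _); apply: sp_in => //.
        by rewrite ffunE eqxx !inE x12.
      apply: submx_trans (addsmxSl _ _); apply: sp_in => //.
      by rewrite ffunE eqxx !inE ix1.
    case/setUP: j'J => j'J.
      apply: submx_trans (addsmxSl _ _); apply: sp_in => //.
      by rewrite ffunE (negPf ne).
    apply: submx_trans (addsmxSr _ _); apply: sp_in => //.
    by rewrite ffunE (negPf ne).
  apply: sp_sub => j' i; rewrite !inE => /and3P [ne j'1 j'2] iX.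
  by rewrite sub_capmx !sp_in // ffunE (negPf ne).
have c1 := cardsC J1; have c2 := cardsC J2.
have c3 := cardsC (J1 :|: J2); have c4 := cardsC ((J1 :&: J2) :\ j).
have c5 := cardsUI J1 J2; have := cardsD1 j (J1 :&: J2).
rewrite inE jJ1 jJ2; lia.
Qed.

(** * Column spans and the formula for the maximal rank *)

(* The transposed coefficient matrices of N ([None] is the constant part), so
   that the columns of N become row vectors. *)
Definition aci_tr (F : fieldType) k m n (N : aci F k m n) (o : option 'I_k) :
  'M[F]_(n, m) := (if o is Some l then aci_coef N l else aci_cst N)^T.

Lemma aci_tr_inj (F : fieldType) k m n (N N' : aci F k m n) :
  aci_tr N =1 aci_tr N' -> N = N'.
Proof.
case: N N' => [c a] [c' a'] h; congr ACI; first exact: trmx_inj (h None).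
by apply: functional_extensionality => l; apply: trmx_inj (h (Some l)).
Qed.

(** An indeterminate occurs in at most one column, so it can take the value wanted by that column
    without conflict. Indeterminates that occur nowhere are set to 0. *)
Lemma completion_glue (F : fieldType) k m n (N : aci F k m n)
    (X : 'I_n -> 'I_k -> F) : isACI N ->
  exists x, forall i j, completion N x i j = completion N (X j) i j.
Proof.
move=> aciN.
exists (fun l => if [pick p | aci_coef N l p.1 p.2 != 0] is Some p
                 then X p.2 l else 0) => i j.
rewrite !mxE !summxE; congr (_ + _); apply: eq_bigr => l _; rewrite !mxE.
have [->|nz] := eqVneq (aci_coef N l i j) 0; first by rewrite !mulr0.
case: pickP => [[i' j'] /= nz'|/(_ (i, j)) /=]; last by rewrite nz.
by rewrite (aciN _ _ _ _ _ nz' nz).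
Qed.

(** The sum of the spaces V_j for j in [J], where V_j is spanned by the constant vector and all
    coefficient vectors of column j. *)
Definition colspan (F : fieldType) k m n (N : aci F k m n) (J : {set 'I_n}) :
  'M[F]_m := (\sum_(j in J) \sum_o <<row j (aci_tr N o)>>)%MS.

Lemma colspan_in (F : fieldType) k m n (N : aci F k m n) (J : {set 'I_n}) j o :
  j \in J -> (row j (aci_tr N o) <= colspan N J)%MS.
Proof.
by move=> jJ; apply: (sumsmx_sup j) => //; apply: (sumsmx_sup o) => //; rewrite genmxE.
Qed.

Lemma colspan_sub (F : fieldType) k m n p (N : aci F k m n) (J : {set 'I_n})
    (A : 'M[F]_(p, m)) :
  (forall j o, j \in J -> (row j (aci_tr N o) <= A)%MS) -> (colspan N J <= A)%MS.
Proof.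
move=> h; apply/sumsmx_subP => j jJ; apply/sumsmx_subP => o _.
by rewrite genmxE h.
Qed.

Lemma colspanS (F : fieldType) k m n (N : aci F k m n) (J K : {set 'I_n}) :
  J \subset K -> (colspan N J <= colspan N K)%MS.
Proof.
by move=> /subsetP sJK; apply: colspan_sub => j o /sJK; apply: colspan_in.
Qed.

Lemma completion_tr (F : fieldType) k m n (N : aci F k m n) x :
  (completion N x)^T = aci_tr N None + \sum_l x l *: aci_tr N (Some l).
Proof.
rewrite /completion raddfD /= raddf_sum /=; congr (_ + _).
by apply: eq_bigr => l _; rewrite linearZ.
Qed.

Lemma completion_row_sub (F : fieldType) k m n (N : aci F k m n) x
    (J : {set 'I_n}) j : j \in J -> (row j (completion N x)^T <= colspan N J)%MS.
Proof.
move=> jJ; rewrite completion_tr raddfD /= raddf_sum /= addmx_sub ?colspan_in //.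
by apply: summx_sub => l _; rewrite linearZ scalemx_sub ?colspan_in.
Qed.

(** The function h of the overview. *)
Definition rankbound (F : fieldType) k m n (N : aci F k m n) (J : {set 'I_n}) :=
  (\rank (colspan N J) + #|~: J|)%N.

(** The columns in [J] stay inside [colspan N J], and each of the others adds at most one
    dimension. *)
Lemma rank_completion_le (F : fieldType) k m n (N : aci F k m n) x J :
  (\rank (completion N x) <= rankbound N J)%N.
Proof.
rewrite -mxrank_tr.
have : ((completion N x)^T <=
    colspan N J + \sum_(j in ~: J) <<row j (completion N x)^T>>)%MS.
  apply/row_subP => j; have [jJ|jJ] := boolP (j \in J).
    by apply: submx_trans (addsmxSl _ _); apply: completion_row_sub.
  apply: submx_trans (addsmxSr _ _); apply: (sumsmx_sup j); rewrite ?inE //.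
  by rewrite genmxE.
move/mxrankS/leq_trans; apply; apply: leq_trans (mxrank_adds_leqif _ _) _.
rewrite leq_add2l; apply: leq_trans (mxrank_sum_leqif _) _ => /=.
rewrite -sum1_card; apply: leq_sum => j _; rewrite genmxE; exact: rank_leq_row.
Qed.

(** The values of column j at the zero assignment and at the k unit assignments span V_j, since a
    coefficient vector is a difference of two of them. Rado's theorem picks one value per column,
    and [completion_glue] realizes all the picks by a single completion. *)
Lemma rankbound_attained (F : fieldType) k m n (N : aci F k m n) r : isACI N ->
  (forall J, r <= rankbound N J)%N -> exists x, (r <= \rank (completion N x))%N.
Proof.
move=> aciN hr.
pose ind (o : option 'I_k) l : F := (o == Some l)%:R.
pose v (j : 'I_n) o := row j (completion N (ind o))^T.
have indN : (completion N (ind None))^T = aci_tr N None.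
  by rewrite completion_tr big1 ?addr0 // => l _; rewrite scale0r.
have indS l : (completion N (ind (Some l)))^T = aci_tr N None + aci_tr N (Some l).
  rewrite completion_tr (bigD1 l) //= /ind eqxx scale1r big1 ?addr0 // => l'.
  by rewrite eq_sym => /negPf; rewrite -(inj_eq (@Some_inj _)) => ->; rewrite scale0r.
have [|phi hphi] := @rado F 'I_n (option 'I_k) None m v r [ffun=> setT].
  move=> J; apply: leq_trans (hr J) _; rewrite leq_add2r; apply/mxrankS.
  have vin j o : j \in J -> (v j o <=
      \sum_(j0 in J) \sum_(i in [ffun=> [set: option 'I_k]] j0) <<v j0 i>>)%MS.
    move=> jJ; apply: (sumsmx_sup j) => //; apply: (sumsmx_sup o).
      by rewrite ffunE inE.
    by rewrite genmxE.
  apply: colspan_sub => j [l|] jJ; last by rewrite -indN vin.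
  have -> : aci_tr N (Some l) =
    (completion N (ind (Some l)))^T - (completion N (ind None))^T.
    by rewrite indN indS addrC addKr.
  by rewrite raddfB /= addmx_sub ?eqmx_opp // vin.
have [x hx] := completion_glue (fun j => ind (phi j)) aciN.
exists x; apply: leq_trans hphi _; rewrite -(mxrank_tr (completion N x)).
apply/mxrankS/sumsmx_subP => j _; rewrite genmxE.
suff -> : v j (phi j) = row j (completion N x)^T by exact: row_sub.
apply/rowP => i; rewrite /v; do 2!rewrite [LHS]mxE; do 2!rewrite [RHS]mxE.
exact/esym/hx.
Qed.

Lemma rankbound_submod (F : fieldType) k m n (N : aci F k m n) J K :
  (rankbound N (J :|: K) + rankbound N (J :&: K) <=
   rankbound N J + rankbound N K)%N.
Proof.
have : (\rank (colspan N (J :|: K)) + \rank (colspan N (J :&: K)) <=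
        \rank (colspan N J) + \rank (colspan N K))%N.
  apply: rank_sub_cap_sum; last first.
    by rewrite sub_capmx !colspanS ?subsetIl ?subsetIr.
  apply: colspan_sub => j o /setUP [] jJ.
    exact: submx_trans (colspan_in _ _ jJ) (addsmxSl _ _).
  exact: submx_trans (colspan_in _ _ jJ) (addsmxSr _ _).
rewrite /rankbound setCU setCI; have := cardsUI (~: J) (~: K); lia.
Qed.

(** * The lattice of minimizers *)

Definition minimizer (F : fieldType) k m n (N : aci F k m n) (J : {set 'I_n}) :=
  forall K, (rankbound N J <= rankbound N K)%N.

Lemma minimizerUI (F : fieldType) k m n (N : aci F k m n) J K :
  minimizer N J -> minimizer N K ->
  minimizer N (J :|: K) /\ minimizer N (J :&: K).
Proof.
move=> hJ hK; have := rankbound_submod N J K.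
have := hJ (J :|: K); have := hJ (J :&: K); have := hK J; have := hJ K.
by split=> L; have := hJ L; lia.
Qed.

(** Minimizers are closed under union and intersection, so one of least cardinality lies inside all
    the others and one of greatest cardinality contains them. *)
Lemma extremal_minimizers (F : fieldType) k m n (N : aci F k m n) :
  exists J1 J2, [/\ minimizer N J1, minimizer N J2 &
    forall J, minimizer N J -> J1 \subset J /\ J \subset J2].
Proof.
pose b J := [forall K, (rankbound N J <= rankbound N K)%N].
have bP J : reflect (minimizer N J) (b J) by apply: forallP.
have [J0 /bP hJ0] : exists J, minimizer N J.
  have [J _ hJ] := @arg_minnP _ set0 predT (rankbound N) isT.
  by exists J => K; apply: hJ.
have [J1 /bP h1 min1] := arg_minnP (fun J : {set 'I_n} => #|J|) hJ0.
have [J2 /bP h2 max2] := arg_maxnP (fun J : {set 'I_n} => #|J|) hJ0.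
exists J1, J2; split=> // J hJ; split.
  have /bP /min1 := (minimizerUI h1 hJ).2.
  by move=> le; apply/setIidPl/eqP; rewrite eqEcard subsetIl.
have /bP /max2 := (minimizerUI h2 hJ).1.
by move=> le; apply/setUidPl/eqP; rewrite eq_sym eqEcard subsetUl.
Qed.

(** * Block decompositions in transposed coordinates *)

Lemma aci_tr_map (F : fieldType) k m n m' n' (f : 'M[F]_(m, n) -> 'M[F]_(m', n'))
    (N : aci F k m n) o : aci_tr (aci_map f N) o = (f (aci_tr N o)^T)^T.
Proof. by case: o => [l|]; rewrite /aci_tr trmxK. Qed.

Lemma aci_zeroP (F : fieldType) k m n (N : aci F k m n) :
  aci_zero N <-> forall o, aci_tr N o = 0.
Proof.
split=> [[h0 h] [l|]|h]; rewrite /aci_tr ?h ?h0 ?trmx0 //.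
by split=> [|l]; apply: trmx_inj; rewrite trmx0; [exact: h None|exact: h (Some l)].
Qed.

Lemma aci_tr_colperm (F : fieldType) k m n p (N : aci F k m n) (R : 'M[F]_(p, m))
    (s : 'S_n) o :
  aci_tr (aci_map (fun A => R *m A *m perm_mx s) N) o =
  row_perm s^-1 (aci_tr N o *m R^T).
Proof.
rewrite aci_tr_map -[s in perm_mx s]invgK -col_permE tr_col_perm trmx_mul.
by rewrite trmxK.
Qed.

Lemma aci_tr_cast_colperm (F : fieldType) k m n (N : aci F k m n) (R : 'M[F]_m)
    (s : 'S_n) o :
  aci_tr (aci_map (castmx (erefl, erefl))
           (aci_map (fun A => R *m A *m perm_mx s) N)) o =
  row_perm s^-1 (aci_tr N o *m R^T).
Proof. by rewrite aci_tr_map castmx_id trmxK aci_tr_colperm. Qed.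

(* The block form of [WST_decomp], transposed: c lists the columns of M in the
   order of the blocks, and A is the transpose of the matrix R. *)
Definition tri_block (F : fieldType) k m n p1 p2 p3 q1 q2 q3 (M : aci F k m n)
    (W : aci F k p1 q1) (S : aci F k p2 q2) (T : aci F k p3 q3)
    (A : 'M[F]_(m, p1 + (p2 + p3))) (B : 'M[F]_(p1 + (p2 + p3), m))
    (c : 'I_(q1 + (q2 + q3)) -> 'I_n) : Prop :=
  [/\ A *m B = 1%:M, B *m A = 1%:M, injective c &
   forall o, exists Y Z, rowsub c (aci_tr M o *m A) =
     block_mx (aci_tr W o) 0 Y (block_mx (aci_tr S o) 0 Z (aci_tr T o))].

(** Replaces the casts along the equations for m and n by an invertible pair [A], [B] of formally
    rectangular matrices and an injection [c], which is bijective by counting. *)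
Lemma WST_decompP (F : fieldType) k m n p1 p2 p3 q1 q2 q3 (M : aci F k m n)
    (W : aci F k p1 q1) (S : aci F k p2 q2) (T : aci F k p3 q3) :
  WST_decomp M W S T <->
  [/\ m = (p1 + (p2 + p3))%N, n = (q1 + (q2 + q3))%N &
      exists A B c, tri_block M W S T A B c] /\
  [/\ wide_or_void p1 q1, isACI W & FmR W] /\
  [/\ square_or_void p2 q2, isACI S & FmR S] /\
  [/\ tall_or_void p3 q3, isACI T & FmR T].
Proof.
split.
  case=> em [en [R [s [uR [h conds]]]]]; split=> //; split=> //.
  subst m n; exists R^T, (invmx R)^T, (s^-1)%g.
  split; rewrite -?trmx_mul ?mulVmx ?mulmxV ?trmx1 //; first exact: perm_inj.
  have tN o := aci_tr_cast_colperm M R s o.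
  move: (aci_map (castmx _) _) h tN => N [/aci_zeroP z1 /aci_zeroP z2 -> -> ->] tN o.
  move: (z1 o) (z2 o); rewrite !aci_tr_map.
  rewrite !(trmx_dlsub, trmx_drsub, trmx_ulsub, trmxK) => z3 z4.
  exists (dlsubmx (aci_tr N o)), (dlsubmx (drsubmx (aci_tr N o))).
  rewrite (_ : rowsub _ _ = aci_tr N o) -?{1}z3 -?z4 ?submxK //.
  by rewrite tN; apply/matrixP => i j; rewrite !mxE.
case=> [[em en [A [B [c [AB BA ci h]]]]] conds]; subst m n.
(* By [aci_tr_cast_colperm], position i of the permuted matrix holds column s^-1 i of [M], and this
   has to be [c i]. *)
pose s := (perm ci)^-1%g.
exists erefl, erefl, A^T, s; split.
  by rewrite unitmx_tr; case/mulmx1_unit: AB.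
have tN o := aci_tr_cast_colperm M A^T s o.
split=> //=; move: (aci_map (castmx _) _) tN => N tN0.
have tN o : aci_tr N o = rowsub c (aci_tr M o *m A).
  rewrite tN0 /s invgK trmxK.
  by apply/matrixP => i j; rewrite !mxE permE.
split; [apply/aci_zeroP => o|apply/aci_zeroP => o|apply: aci_tr_inj => o..];
  rewrite !aci_tr_map !(trmx_dlsub, trmx_drsub, trmx_ulsub, trmxK) tN;
  case: (h o) => [Y [Z ->]];
  by rewrite ?block_mxKdr ?block_mxKdl ?block_mxKur ?block_mxKul ?trmx0.
Qed.

Lemma tri_block_rows (F : fieldType) k m n p1 p2 p3 q1 q2 q3 (M : aci F k m n)
    (W : aci F k p1 q1) (S : aci F k p2 q2) (T : aci F k p3 q3) A B c :
  tri_block M W S T A B c -> forall o,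
  [/\ forall i, row (c (lshift _ i)) (aci_tr M o) *m A = row_mx (row i (aci_tr W o)) 0,
      forall i, exists y, row (c (rshift _ (lshift _ i))) (aci_tr M o) *m A =
        row_mx y (row_mx (row i (aci_tr S o)) 0) &
      forall i, exists y z, row (c (rshift _ (rshift _ i))) (aci_tr M o) *m A =
        row_mx y (row_mx z (row i (aci_tr T o)))].
Proof.
case=> _ _ _ h o; case: (h o) => [Y [Z e]].
have r i : row (c i) (aci_tr M o) *m A = row i (rowsub c (aci_tr M o *m A)).
  by rewrite -row_mul row_rowsub.
split=> i; rewrite r e /block_mx.
- by rewrite rowKu row_row_mx row0.
- by exists (row (lshift _ i) Y); rewrite rowKd row_row_mx rowKu row_row_mx row0.
by exists (row (rshift _ i) Y), (row i Z); rewrite rowKd row_row_mx rowKd row_row_mx.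
Qed.

(** * Column spans and ranks of single blocks *)

Lemma card_preim_split n a b d (c : 'I_(a + (b + d)) -> 'I_n) (J : {set 'I_n}) :
  n = (a + (b + d))%N -> injective c ->
  #|J| = (#|[set i | c (lshift _ i) \in J]| +
    (#|[set i | c (rshift _ (lshift _ i)) \in J]| +
     #|[set i | c (rshift _ (rshift _ i)) \in J]|))%N.
Proof.
move=> en ci; subst n; rewrite -!sum1_card !(big_mkcond (fun i => i \in _)) /=.
rewrite (reindex_inj ci) /= big_split_ord big_split_ord /=.
by congr (_ + (_ + _))%N; apply: eq_bigr => i _; rewrite inE.
Qed.

(** Rank-nullity for [C] on the span of [J]: the image contains the span of the block columns lying
    in [J], and the kernel contains the span of [K]. *)
Lemma colspan_block_ge (F : fieldType) k m n p q (M : aci F k m n)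
    (N : aci F k p q) (c : 'I_q -> 'I_n) (C : 'M[F]_(m, p)) (J K : {set 'I_n}) :
  K \subset J ->
  (forall o i, row (c i) (aci_tr M o) *m C = row i (aci_tr N o)) ->
  (forall o j, j \in K -> row j (aci_tr M o) *m C = 0) ->
  (\rank (colspan N [set i | c i \in J]) + \rank (colspan M K) <=
   \rank (colspan M J))%N.
Proof.
move=> sKJ hN hK; rewrite -(mxrank_mul_ker (colspan M J) C); apply: leq_add.
  apply/mxrankS/colspan_sub => i o; rewrite inE => /colspan_in h.
  by rewrite -hN submxMr.
apply: mxrankS; rewrite sub_capmx colspanS //=.
by apply: colspan_sub => j o jK; rewrite sub_kermx hK.
Qed.

Lemma colspan_block_le (F : fieldType) k m n p q (M : aci F k m n)
    (N : aci F k p q) (c : 'I_q -> 'I_n) (C : 'M[F]_(m, p)) (X : {set 'I_n})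
    (J : {set 'I_q}) :
  (forall o i, row (c i) (aci_tr M o) *m C = row i (aci_tr N o)) ->
  (forall o j, j \in X -> row j (aci_tr M o) *m C = 0) ->
  (\rank (colspan M (X :|: c @: J) *m C) <= \rank (colspan N J))%N.
Proof.
move=> hN hX; apply: mxrankS.
have h j o : j \in X :|: c @: J ->
    (* This kernel is the preimage of [colspan N J] under [C]. *)
    (row j (aci_tr M o) <= kermx (C *m cokermx (colspan N J)))%MS.
  rewrite sub_kermx mulmxA.
  case/setUP => [/hX ->|/imsetP [i iJ ->]]; first by rewrite mul0mx.
  by rewrite hN -submxE colspan_in.
by have /colspan_sub := h; rewrite sub_kermx mulmxA -submxE.
Qed.

(** With [FmR_rankbound], this trades FmR for lower bounds on [rankbound]; the upper bound on the
    rank is automatic from the size. *)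
Lemma FmR_intro (F : fieldType) k m n (N : aci F k m n) : isACI N ->
  (forall J, minn m n <= rankbound N J)%N -> FmR N.
Proof.
move=> aciN /(rankbound_attained aciN) [x hx].
have le y : (\rank (completion N y) <= minn m n)%N.
  by rewrite leq_min rank_leq_row rank_leq_col.
by split=> //; exists x; apply/eqP; rewrite eqn_leq le.
Qed.

Lemma FmR_rankbound (F : fieldType) k m n (N : aci F k m n) J : FmR N ->
  (minn m n <= rankbound N J)%N.
Proof. by case=> [[x <-] _]; apply: rank_completion_le. Qed.

(** A completion of rank m has independent rows. Its transpose is a linear combination of the
    [aci_tr N o], hence annihilates [X], which forces [X] to vanish. *)
Lemma FmR_inj (F : fieldType) k m n p (N : aci F k m n) (X : 'M[F]_(m, p)) :
  FmR N -> (m <= n)%N -> (forall o, aci_tr N o *m X = 0) -> X = 0.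
Proof.
move=> [[x rx] _] le_mn hX; apply: trmx_inj; rewrite trmx0; apply/eqP.
have fx : row_free (completion N x) by rewrite -row_leq_rank rx leq_min leqnn.
rewrite -(mulmx_free_eq0 _ fx) -trmx_eq0 trmx_mul trmxK completion_tr.
rewrite mulmxDl hX add0r mulmx_suml big1 // => l _.
by rewrite -scalemxAl hX scaler0.
Qed.

(** [D] plays the transition matrix between two block forms. Its upper right block is annihilated by
    every coefficient matrix of [N], so it is zero by [FmR_inj]. *)
Lemma block_transition (F : fieldType) k p p' q (N N' : aci F k p q)
    (D : 'M[F]_(p + p')) (s : 'S_q) : FmR N -> (p <= q)%N ->
  (forall o i, row_mx (row i (aci_tr N' o)) 0 =
               row_mx (row (s i) (aci_tr N o)) 0 *m D) ->
  ursubmx D = 0 /\ forall o, aci_tr N' o = row_perm s (aci_tr N o *m ulsubmx D).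
Proof.
move=> fN le_pq h.
have h2 o i : row i (aci_tr N' o) = row (s i) (aci_tr N o) *m ulsubmx D /\
              0 = row (s i) (aci_tr N o) *m ursubmx D.
  have := h o i; rewrite -{1}[D]submxK mul_row_block !mul0mx !addr0.
  exact: eq_row_mx.
split; last first.
  move=> o; apply/row_matrixP => i; rewrite (h2 o i).1 -row_mul.
  by apply/rowP => j; rewrite !mxE.
apply: (FmR_inj fN le_pq) => o; apply/row_matrixP => i.
by rewrite row0 row_mul -[i](permKV s) -(h2 _ _).2.
Qed.

Lemma aci_equiv_intro (F : fieldType) k p q (N N' : aci F k p q) (s : 'S_q)
    (E : 'M[F]_p) : E \in unitmx ->
  (forall o, aci_tr N' o = row_perm s (aci_tr N o *m E)) -> aci_equiv N N'.
Proof.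
move=> uE h; exists erefl, erefl, E^T, (s^-1)%g; rewrite unitmx_tr; split=> //.
apply: aci_tr_inj => o; rewrite aci_tr_colperm invgK trmxK h.
by rewrite aci_tr_map castmx_id trmxK.
Qed.

Lemma same_image_perm (T : finType) q (f g : 'I_q -> T) : injective f ->
  injective g -> [set f i | i : 'I_q] = [set g i | i : 'I_q] ->
  exists s : 'S_q, forall i, g i = f (s i).
Proof.
move=> fi gi e.
have h i : exists i', g i == f i'.
  have : g i \in [set f i | i : 'I_q] by rewrite e imset_f.
  by case/imsetP => i' _ ->; exists i'.
have hs i : g i = f (xchoose (h i)) by apply/eqP/(xchooseP (h i)).
have si : injective (fun i => xchoose (h i)).
  by move=> i j e'; apply: gi; rewrite !hs e'.
by exists (perm si) => i; rewrite permE.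
Qed.

Lemma inj_split_cases n a b d (c : 'I_(a + (b + d)) -> 'I_n) :
  n = (a + (b + d))%N -> injective c -> forall j,
  [\/ exists i, j = c (lshift _ i), exists i, j = c (rshift _ (lshift _ i)) |
      exists i, j = c (rshift _ (rshift _ i))].
Proof.
move=> en ci j.
have /codomP [i ->] : j \in codom c by apply: inj_card_onto => //; rewrite !card_ord -en.
case: (split_ordP i) => i1 ->; first by constructor 1; exists i1.
case: (split_ordP i1) => i2 ->; first by constructor 2; exists i2.
by constructor 3; exists i2.
Qed.

(** * From a decomposition to a pair of minimizers *)

(** The FmR bounds of the three blocks add up to p1 + q2 + q3 as a lower bound for [rankbound M] at
    every set. The zero blocks confine the spans of [J1] and [~: J3] to dimensions p1 and p1 + p2,
    so these two sets attain the bound. *)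
Lemma decomp_minimizers (F : fieldType) k m n p1 p2 p3 q1 q2 q3 (M : aci F k m n)
    (W : aci F k p1 q1) (S : aci F k p2 q2) (T : aci F k p3 q3) A B c
    (J1 := [set c (lshift _ i) | i : 'I_q1])
    (J3 := [set c (rshift _ (rshift _ i)) | i : 'I_q3]) :
  n = (q1 + (q2 + q3))%N -> tri_block M W S T A B c ->
  (p1 <= q1)%N -> p2 = q2 -> (q3 <= p3)%N -> FmR W -> FmR S -> FmR T ->
  [/\ minimizer M J1, minimizer M (~: J3), J1 \subset ~: J3,
      q2 = #|~: J3 :\: J1| & rankbound M J1 = (p1 + (q2 + q3))%N].
Proof.
move=> en tri le1 e2 le3 fW fS fT; have rows := tri_block_rows tri.
case: (tri) => AB _ ci _.
have cases := inj_split_cases en ci.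
have c1J1 i : c (lshift _ i) \in J1 by apply: imset_f.
have c3J3 i : c (rshift _ (rshift _ i)) \in J3 by apply: imset_f.
have c1J3 i : c (lshift _ i) \notin J3.
  by apply/imsetP => [[j _ /ci /eqP]]; rewrite eq_lrshift.
have c2J3 i : c (rshift _ (lshift _ i)) \notin J3.
  by apply/imsetP => [[j _ /ci /rshift_inj /eqP]]; rewrite eq_lrshift.
have c2J1 i : c (rshift _ (lshift _ i)) \notin J1.
  by apply/imsetP => [[j _ /ci /eqP]]; rewrite eq_rlshift.
have c3J1 i : c (rshift _ (rshift _ i)) \notin J1.
  by apply/imsetP => [[j _ /ci /eqP]]; rewrite eq_rlshift.
have sJ : J1 \subset ~: J3.
  by apply/subsetP => j /imsetP [i _ ->]; rewrite inE c1J3.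
have cJ1 : #|J1| = q1.
  by rewrite card_imset ?card_ord // => i j /ci /lshift_inj.
have cJ3 : #|J3| = q3.
  by rewrite card_imset ?card_ord // => i j /ci /rshift_inj /rshift_inj.
have cardJ : q2 = #|~: J3 :\: J1|.
  have := cardsC J3; rewrite cardsDS // cJ1 cJ3 card_ord; lia.
(* The span of [J] is filtered by those of [J :&: ~: J3] and [J :&: J1]; the three successive
   quotients are measured in the coordinates of T, S and W. *)
have lower J : (p1 + (q2 + q3) <= rankbound M J)%N.
  have hT : (\rank (colspan T [set i | c (rshift _ (rshift _ i)) \in J]) +
      \rank (colspan M (J :&: ~: J3)) <= \rank (colspan M J))%N.
    apply: (colspan_block_ge (C := rsubmx (rsubmx A))); first exact: subsetIl.
      move=> o i; case: (rows o) => _ _ /(_ i) [y [z e]].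
      by rewrite !mulmx_rsub e !row_mxKr.
    move=> o j; rewrite !inE => /andP [_].
    case: (cases j) => [[i ->] _|[i ->] _|[i ->]]; last by rewrite c3J3.
      by case: (rows o) => /(_ i) e _ _; rewrite !mulmx_rsub e row_mxKr raddf0.
    case: (rows o) => _ /(_ i) [y e] _.
    by rewrite !mulmx_rsub e !row_mxKr.
  have hS : (\rank (colspan S [set i | c (rshift _ (lshift _ i)) \in J :&: ~: J3]) +
      \rank (colspan M (J :&: J1)) <= \rank (colspan M (J :&: ~: J3)))%N.
    apply: (colspan_block_ge (C := lsubmx (rsubmx A))); first exact: setIS.
      move=> o i; case: (rows o) => _ /(_ i) [y e] _.
      by rewrite mulmx_lsub !mulmx_rsub e !(row_mxKr, row_mxKl).
    move=> o j /setIP [_ /imsetP [i _ ->]].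
    by case: (rows o) => /(_ i) e _ _; rewrite mulmx_lsub mulmx_rsub e row_mxKr raddf0.
  have hW : (\rank (colspan W [set i | c (lshift _ i) \in J :&: J1]) +
      \rank (colspan M set0) <= \rank (colspan M (J :&: J1)))%N.
    apply: (colspan_block_ge (C := lsubmx A)); first exact: sub0set.
      by move=> o i; case: (rows o) => /(_ i) e _ _; rewrite mulmx_lsub e row_mxKl.
    by move=> o j; rewrite inE.
  have := FmR_rankbound [set i | c (lshift _ i) \in J :&: J1] fW.
  have := FmR_rankbound [set i | c (rshift _ (lshift _ i)) \in J :&: ~: J3] fS.
  have := FmR_rankbound [set i | c (rshift _ (rshift _ i)) \in J] fT.
  rewrite /rankbound (card_preim_split (~: J) en ci).
  have -> : ~: [set i | c (lshift _ i) \in J :&: J1] =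
            [set i | c (lshift _ i) \in ~: J].
    by apply/setP => i; rewrite !inE c1J1 andbT.
  have -> : ~: [set i | c (rshift _ (lshift _ i)) \in J :&: ~: J3] =
            [set i | c (rshift _ (lshift _ i)) \in ~: J].
    by apply/setP => i; rewrite !inE c2J3 andbT.
  have -> : ~: [set i | c (rshift _ (rshift _ i)) \in J] =
            [set i | c (rshift _ (rshift _ i)) \in ~: J].
    by apply/setP => i; rewrite !inE.
  have arith dW dS dT d0 x y z aW aS aT : (dT + y <= z)%N -> (dS + x <= y)%N ->
      (dW + d0 <= x)%N -> (minn p3 q3 <= dT + aT)%N ->
      (minn p2 q2 <= dS + aS)%N -> (minn p1 q1 <= dW + aW)%N ->
      (p1 + (q2 + q3) <= z + (aW + (aS + aT)))%N by lia.
  exact: arith hT hS hW.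
have rowB j o : row j (aci_tr M o) = row j (aci_tr M o) *m A *m B.
  by rewrite -mulmxA AB mulmx1.
(* In the coordinates given by [A], a column of [J1] has only its first p1 entries nonzero, so it is
   a combination of the first p1 rows of [B]. *)
have up1 : (\rank (colspan M J1) <= p1)%N.
  apply: leq_trans (rank_leq_row (usubmx B)); apply/mxrankS/colspan_sub.
  move=> j o /imsetP [i _ ->]; case: (rows o) => /(_ i) e _ _.
  by rewrite rowB e -{1}[B]vsubmxK mul_row_col mul0mx addr0 submxMl.
have up2 : (\rank (colspan M (~: J3)) <= p1 + p2)%N.
  apply: leq_trans (leq_add (rank_leq_row (usubmx B))
                            (rank_leq_row (usubmx (dsubmx B)))).
  apply: leq_trans (mxrank_adds_leqif _ _); apply/mxrankS/colspan_sub.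
  have h (x : 'rV_p1) (y : 'rV_p2) :
      (row_mx x (row_mx y 0) *m B <= usubmx B + usubmx (dsubmx B))%MS.
    rewrite -{1}[B]vsubmxK mul_row_col -{1}[dsubmx B]vsubmxK mul_row_col mul0mx.
    by rewrite addr0 addmx_sub_adds ?submxMl.
  move=> j o; rewrite inE rowB.
  case: (cases j) => [[i ->] _|[i ->] _|[i ->]]; last by rewrite c3J3.
    by case: (rows o) => /(_ i) -> _ _; rewrite -(@row_mx0 _ 1 p2 p3) h.
  by case: (rows o) => _ /(_ i) [y ->] _.
have rb1 : (rankbound M J1 <= p1 + (q2 + q3))%N.
  by apply: leq_add up1 _; rewrite cardsCs setCK cJ1 card_ord; lia.
split=> // [J|J|]; last by apply/eqP; rewrite eqn_leq rb1 lower.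
  exact: leq_trans rb1 (lower J).
by apply: leq_trans (lower J); rewrite /rankbound setCK cJ3 addnA leq_add2r -e2.
Qed.

(** * From the extremal minimizers to a decomposition *)

Lemma mulmx1_square (F : fieldType) m n (A : 'M[F]_(m, n)) (B : 'M[F]_(n, m)) :
  m = n -> A *m B = 1%:M -> B *m A = 1%:M.
Proof. by move=> e; subst n; apply: mulmx1C. Qed.

(** Column i of [N] is a constant linear image of column [c i] of [M], so it contains no
    indeterminate that is absent from the latter. *)
Lemma isACI_sub (F : fieldType) k m n p q (M : aci F k m n) (N : aci F k p q)
    (c : 'I_q -> 'I_n) (C : 'M[F]_(m, p)) : injective c ->
  (forall o, aci_tr N o = rowsub c (aci_tr M o *m C)) -> isACI M -> isACI N.
Proof.
move=> ci hN aciM l i1 i2 j1 j2.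
have nz i j : aci_coef N l i j != 0 -> exists a, aci_coef M l a (c j) != 0.
  have -> : aci_coef N l i j = aci_tr N (Some l) j i by rewrite mxE.
  rewrite hN !mxE => nz; apply/existsP; apply: contraNT nz.
  rewrite negb_exists => /forallP z; apply/eqP/big1 => a _.
  by have /negPn/eqP e := z a; rewrite mxE e mul0r.
by move=> /nz [a1 h1] /nz [a2 h2]; apply: ci; apply: aciM h1 h2.
Qed.

Lemma rank_le_sum3 (F : fieldType) p m p1 p2 p3 (A : 'M[F]_(m, p1 + (p2 + p3)))
    (B : 'M[F]_(p1 + (p2 + p3), m)) (Y : 'M[F]_(p, m)) : A *m B = 1%:M ->
  (\rank Y <= \rank (Y *m lsubmx A) + (\rank (Y *m lsubmx (rsubmx A)) +
              \rank (Y *m rsubmx (rsubmx A))))%N.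
Proof.
move=> AB.
rewrite -{1}[Y]mulmx1 -AB -{1}[A]hsubmxK -{1}[B]vsubmxK mul_row_col.
rewrite -{1}[rsubmx A]hsubmxK -{1}[dsubmx B]vsubmxK mul_row_col !mulmxDr !mulmxA.
apply: leq_trans (mxrank_add _ _) (leq_add (mxrankM_maxl _ _) _).
exact: leq_trans (mxrank_add _ _) (leq_add (mxrankM_maxl _ _) (mxrankM_maxl _ _)).
Qed.

(** The rows of [B] form a basis of [U1], then of a complement of [U1] in [U2], then of a complement
    of [U2]. The columns of the inverse [A] are the dual coordinates, so the later ones vanish on
    [U1] or on [U2]. *)
Lemma adapted_basis (F : fieldType) m (U1 U2 : 'M[F]_m) : (U1 <= U2)%MS ->
  exists p1 p2 p3 (A : 'M[F]_(m, p1 + (p2 + p3))) (B : 'M[F]_(p1 + (p2 + p3), m)),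
  [/\ A *m B = 1%:M, B *m A = 1%:M, U1 *m rsubmx A = 0 &
      U2 *m rsubmx (rsubmx A) = 0] /\
  [/\ p1 = \rank U1, (p1 + p2)%N = \rank U2 & m = (p1 + (p2 + p3))%N].
Proof.
move=> sU.
pose B1 := row_base U1; pose B2 := row_base (U2 :\: U1)%MS.
pose B3 := row_base (U2^C)%MS; pose B := col_mx B1 (col_mx B2 B3).
have sU2 : (U2 <= B1 + B2)%MS.
  rewrite -(addsmx_diff_cap_eq U2 U1) addsmxC addsmxS ?eq_row_base //.
  exact: capmxSr.
have fB : row_full B.
  rewrite -sub1mx; have := addsmx_compl_full U2; rewrite -sub1mx => /submx_trans; apply.
  rewrite addsmx_sub; apply/andP; split.
    apply: submx_trans sU2 _; rewrite addsmx_sub /B -!addsmxE addsmxSl.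
    by apply: submx_trans (addsmxSr _ _); rewrite -addsmxE addsmxSl.
  rewrite /B -addsmxE; apply: submx_trans (addsmxSr _ _).
  by rewrite -addsmxE; apply: submx_trans (addsmxSr _ _); rewrite eq_row_base.
have /row_fullP [A AB] := fB.
have e2 : (\rank U1 + \rank (U2 :\: U1)%MS = \rank U2)%N.
  by rewrite -(mxrank_cap_compl U2 U1) (capmx_idPr sU).
have em : m = (\rank U1 + (\rank (U2 :\: U1)%MS + \rank (U2^C)%MS))%N.
  by rewrite addnA e2 mxrank_compl subnKC ?rank_leq_row.
have BA : B *m A = 1%:M by apply: mulmx1_square AB.
have B1A : B1 *m rsubmx A = 0.
  have := BA; rewrite /B mul_col_mx -[A in B1 *m A]hsubmxK mul_mx_row.
  by move/(congr1 usubmx); rewrite col_mxKu => /(congr1 rsubmx);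
    rewrite row_mxKr => ->; rewrite scalar_mx_block -/(ursubmx _) block_mxKur.
have B2A : B2 *m rsubmx (rsubmx A) = 0.
  have : col_mx B2 B3 *m rsubmx A = 1%:M.
    have := BA; rewrite /B mul_col_mx => /(congr1 dsubmx); rewrite col_mxKd.
    move/(congr1 rsubmx); rewrite -mulmx_rsub => ->.
    by rewrite scalar_mx_block -/(drsubmx _) block_mxKdr.
  rewrite mul_col_mx => /(congr1 usubmx); rewrite col_mxKu => /(congr1 rsubmx).
  by rewrite -mulmx_rsub => ->; rewrite scalar_mx_block -/(ursubmx _) block_mxKur.
exists (\rank U1), (\rank (U2 :\: U1)%MS), (\rank (U2^C)%MS), A, B; split; split=> //.
  have /submxP [X eX] : (U1 <= B1)%MS by rewrite eq_row_base.
  by apply: etrans (congr1 (mulmx^~ _) eX) _; rewrite -mulmxA B1A mulmx0.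
have /sub_addsmxP [[X Y] eX] := sU2; apply: etrans (congr1 (mulmx^~ _) eX) _.
by rewrite /= mulmxDl -(mulmxA X) -(mulmxA Y) B2A mulmx_rsub B1A !raddf0 addr0.
Qed.

Lemma sorted_columns n (J1 J2 : {set 'I_n}) : J1 \subset J2 ->
  exists q1 q2 q3 (c : 'I_(q1 + (q2 + q3)) -> 'I_n),
  [/\ injective c, forall i, c (lshift _ i) \in J1,
      forall i, c (rshift _ (lshift _ i)) \in J2 :\: J1 &
      forall i, c (rshift _ (rshift _ i)) \in ~: J2] /\
  [/\ q1 = #|J1|, q2 = #|J2 :\: J1|, q3 = #|~: J2| & n = (q1 + (q2 + q3))%N].
Proof.
move=> /subsetP sJ.
exists #|J1|, #|J2 :\: J1|, #|~: J2|.
pose c (i : 'I_(#|J1| + (#|J2 :\: J1| + #|~: J2|))) : 'I_n := match split i with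
  | inl i1 => enum_val i1
  | inr i' => match split i' with inl i2 => enum_val i2 | inr i3 => enum_val i3 end
  end.
have c1 i : c (lshift _ i) = enum_val i by rewrite /c (unsplitK (inl _ i)).
have c2 i : c (rshift _ (lshift _ i)) = enum_val i.
  by rewrite /c (unsplitK (inr _ _)) (unsplitK (inl _ _)).
have c3 i : c (rshift _ (rshift _ i)) = enum_val i.
  by rewrite /c (unsplitK (inr _ _)) (unsplitK (inr _ _)).
exists c; split; split=> //.
- have v1 (i : 'I_#|J1|) := enum_valP i.
  have v2 (i : 'I_#|J2 :\: J1|) : (enum_val i \in J2) && (enum_val i \notin J1).
    by have := enum_valP i; rewrite inE andbC.
  have v3 (i : 'I_#|~: J2|) : (enum_val i \notin J2) && (enum_val i \notin J1).
    have := enum_valP i; rewrite inE => h; rewrite h.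
    by apply: contra h => /sJ.
  move=> i j; case: (split_ordP i) => i1 ->; case: (split_ordP j) => j1 ->.
  + by rewrite !c1 => /enum_val_inj ->.
  + case: (split_ordP j1) => j2 ->; rewrite c1 ?c2 ?c3 => e.
      by have := v2 j2; rewrite -e v1 andbF.
    by have := v3 j2; rewrite -e v1 andbF.
  + case: (split_ordP i1) => i2 ->; rewrite c1 ?c2 ?c3 => e.
      by have := v2 i2; rewrite e v1 andbF.
    by have := v3 i2; rewrite e v1 andbF.
  case: (split_ordP i1) => i2 ->; case: (split_ordP j1) => j2 ->;
    rewrite ?c2 ?c3 => e.
  + by rewrite (enum_val_inj e).
  + by have /andP [h _] := v2 i2; have := v3 j2; rewrite -e h.
  + by have /andP [h _] := v2 j2; have := v3 i2; rewrite e h.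
  by rewrite (enum_val_inj e).
- by move=> i; rewrite c1 enum_valP.
- by move=> i; rewrite c2 enum_valP.
- by move=> i; rewrite c3 enum_valP.
have sJ' : J1 \subset J2 by apply/subsetP.
by rewrite addnA cardsDS // subnKC ?subset_leq_card // cardsC card_ord.
Qed.

(** Carries a lower bound r for [rankbound M] over to a block whose coordinates [C] kill the columns
    in [X]; a bounds the dimension that [C] loses on the relevant span. Taking r to be the minimum
    leaves exactly the inequality required by [FmR_intro]. *)
Lemma rankbound_block (F : fieldType) k m n p q (M : aci F k m n)
    (N : aci F k p q) (d : 'I_q -> 'I_n) (C : 'M[F]_(m, p)) (X : {set 'I_n})
    (J : {set 'I_q}) a r :
  injective d -> (forall i, d i \notin X) ->
  (forall o, aci_tr N o = rowsub d (aci_tr M o *m C)) ->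
  (forall o j, j \in X -> row j (aci_tr M o) *m C = 0) ->
  (\rank (colspan M (X :|: d @: J)) <=
     a + \rank (colspan M (X :|: d @: J) *m C))%N ->
  (r <= rankbound M (X :|: d @: J))%N ->
  (r + q <= a + rankbound N J + #|~: X|)%N.
Proof.
move=> di dX tN zX hY hr.
have hN o i : row (d i) (aci_tr M o) *m C = row i (aci_tr N o).
  by rewrite tN row_rowsub row_mul.
have le := colspan_block_le J hN zX.
have cX : (#|~: (X :|: d @: J)| + #|J|)%N = #|~: X|.
  have sJ : d @: J \subset ~: X.
    by apply/subsetP => j /imsetP [i _ ->]; rewrite inE.
  rewrite setCU -setDE cardsDS // card_imset // subnK //.
  by rewrite -(card_imset _ di) subset_leq_card.
have cJ : (#|J| + #|~: J|)%N = q by rewrite cardsC card_ord.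
have arith y z w x xj j j' : (y <= a + z)%N -> (r <= y + xj)%N -> (z <= w)%N ->
  (xj + j)%N = x -> (j + j')%N = q -> (r + q <= a + (w + j') + x)%N by lia.
exact: arith hY hr le cX cJ.
Qed.

(** The blocks come from a basis adapted to the spans of [J1] and [J2]. Minimality makes them FmR,
    equality of the two minimal values makes S square, and extremality makes W strictly wide or void
    and T strictly tall or void. *)
Lemma exists_decomp (F : fieldType) k m n (M : aci F k m n) J1 J2 : isACI M ->
  minimizer M J1 -> minimizer M J2 ->
  (forall J, minimizer M J -> J1 \subset J /\ J \subset J2) ->
  exists p1 p2 p3 q1 q2 q3 (W : aci F k p1 q1) (S : aci F k p2 q2)
    (T : aci F k p3 q3), WST_decomp M W S T /\ p2 = #|J2 :\: J1|.
Proof.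
move=> aciM min1 min2 ext; have [_ sJ] := ext _ min1.
have [p1 [p2 [p3 [A [B [[AB BA U1A U2A] [e1 e12 em]]]]]]] :=
  adapted_basis (colspanS M sJ).
have [q1 [q2 [q3 [c [[ci cJ1 cJ2 cJ3] [eq1 eq2 eq3 en]]]]]] := sorted_columns sJ.
have cC1 : #|~: J1| = (q2 + q3)%N.
  by rewrite cardsCs setCK -eq1 card_ord en addKn.
have rb1 : rankbound M J1 = (p1 + (q2 + q3))%N by rewrite /rankbound cC1 -e1.
have rb2 : rankbound M J2 = (p1 + p2 + q3)%N by rewrite /rankbound -eq3 -e12.
have e22 : p2 = q2.
  have := min1 J2; have := min2 J1; rewrite rb1 rb2; lia.
have rb0 : rankbound M set0 = n.
  rewrite /rankbound setC0 cardsT card_ord [X in \rank X](_ : _ = 0) ?mxrank0 //.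
  by rewrite /colspan big_set0.
have rbT : (rankbound M setT <= m)%N.
  by rewrite /rankbound setCT cards0 addn0 rank_leq_row.
pose sub p q (d : 'I_q -> 'I_n) (C : 'M[F]_(m, p)) :=
  aci_map (fun X => (rowsub d (X^T *m C))^T) M.
have tsub p q (d : 'I_q -> 'I_n) (C : 'M[F]_(m, p)) o :
    aci_tr (sub p q d C) o = rowsub d (aci_tr M o *m C).
  by rewrite /sub aci_tr_map !trmxK.
have rsub p q (d : 'I_q -> 'I_n) (C : 'M[F]_(m, p)) o i :
    row (d i) (aci_tr M o) *m C = row i (aci_tr (sub p q d C) o).
  by rewrite tsub row_rowsub row_mul.
have zero1 o j : j \in J1 -> row j (aci_tr M o) *m rsubmx A = 0.
  by move=> /(colspan_in M o) /submxP [X ->]; rewrite -mulmxA U1A mulmx0.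
have zero2 o j : j \in J2 -> row j (aci_tr M o) *m rsubmx (rsubmx A) = 0.
  by move=> /(colspan_in M o) /submxP [X ->]; rewrite -mulmxA U2A mulmx0.
have sub0 p (J K : {set 'I_n}) (C : 'M[F]_(m, p)) : J \subset K -> colspan M K *m C = 0 ->
    colspan M J *m C = 0.
  by move=> /(colspanS M) /submxP [X ->] h; rewrite -mulmxA h mulmx0.
pose c1 i := c (lshift (q2 + q3) i).
pose c2 i := c (rshift q1 (lshift q3 i)).
pose c3 i := c (rshift q1 (rshift q2 i)).
have c1i : injective c1 by move=> i j /ci /lshift_inj.
have c2i : injective c2 by move=> i j /ci /rshift_inj /lshift_inj.
have c3i : injective c3 by move=> i j /ci /rshift_inj /rshift_inj.
pose W := sub p1 q1 c1 (lsubmx A).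
pose S := sub p2 q2 c2 (lsubmx (rsubmx A)).
pose T := sub p3 q3 c3 (rsubmx (rsubmx A)).
have aW : isACI W by apply: isACI_sub (tsub _ _ c1 _) aciM.
have aS : isACI S by apply: isACI_sub (tsub _ _ c2 _) aciM.
have aT : isACI T by apply: isACI_sub (tsub _ _ c3 _) aciM.
exists p1, p2, p3, q1, q2, q3, W, S, T; split; last by rewrite e22.
apply/WST_decompP; split; [split=> //; exists A, B, c; split=> // o|].
  set H := rowsub c _.
  have [eW eS eT] : [/\ ulsubmx H = aci_tr W o,
      ulsubmx (drsubmx H) = aci_tr S o & drsubmx (drsubmx H) = aci_tr T o].
    by rewrite !tsub; split; apply/matrixP => i j; rewrite !mxE;
      apply: eq_bigr => a _; rewrite !mxE.
  have z1 : ursubmx H = 0.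
    apply/row_matrixP => i; rewrite row0 -[RHS](zero1 o _ (cJ1 i)).
    by apply/rowP => j; rewrite !mxE; apply: eq_bigr => a _; rewrite !mxE.
  have z2 : ursubmx (drsubmx H) = 0.
    have h i : c (rshift q1 (lshift q3 i)) \in J2 by case/setDP: (cJ2 i).
    apply/row_matrixP => i; rewrite row0 -[RHS](zero2 o _ (h i)).
    by apply/rowP => j; rewrite !mxE; apply: eq_bigr => a _; rewrite !mxE.
  exists (dlsubmx H), (dlsubmx (drsubmx H)).
  by rewrite -eW -eS -eT -z1 -{1}z2 !submxK.
split; [|split]; split=> //.
(* Comparison with [set0], where the bound is n, gives p1 <= q1. In case of equality [set0] is a
   minimizer, so [J1] is empty and W is void. *)
- have := min1 set0; rewrite rb1 rb0 leq_eqVlt => /orP [/eqP e|]; last by left; lia.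
  have /ext [s0 _] : minimizer M set0 by move=> K; apply: leq_trans (min1 K); rewrite rb0 rb1 e.
  have q10 : q1 = 0%N by apply/eqP; rewrite eq1 cards_eq0 -subset0.
  by right; lia.
- apply: FmR_intro => // J.
  have zA : colspan M (set0 :|: c1 @: J) *m rsubmx A = 0.
    apply: sub0 U1A; rewrite set0U; apply/subsetP => _ /imsetP [i _ ->]; exact: cJ1.
  have dX i : c1 i \notin set0 by rewrite inE.
  have zX o j : j \in set0 -> row j (aci_tr M o) *m lsubmx A = 0 by rewrite inE.
  have hY : (\rank (colspan M (set0 :|: c1 @: J)) <=
      0 + \rank (colspan M (set0 :|: c1 @: J) *m lsubmx A))%N.
    have := rank_le_sum3 (colspan M (set0 :|: c1 @: J)) AB.
    by rewrite (mulmx_lsub _ (rsubmx A)) (mulmx_rsub _ (rsubmx A)) zA !raddf0 !mxrank0 !addn0.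
  have := rankbound_block c1i dX (tsub _ _ c1 _) zX hY (min1 _).
  (* Here a = 0 and [X] is empty; S uses a = p1 with [X] = [J1], and T uses a = p1 + p2 with [X] =
     [J2]. *)
  rewrite setC0 cardsT card_ord rb1 -/W; lia.
- apply: FmR_intro => // J.
  have zA : colspan M (J1 :|: c2 @: J) *m rsubmx (rsubmx A) = 0.
    apply: sub0 U2A; rewrite subUset sJ; apply/subsetP => _ /imsetP [i _ ->].
    by case/setDP: (cJ2 i).
  have dX i : c2 i \notin J1 by case/setDP: (cJ2 i).
  have zX o j : j \in J1 -> row j (aci_tr M o) *m lsubmx (rsubmx A) = 0.
    by move=> jJ; rewrite mulmx_lsub zero1 ?raddf0.
  have hY : (\rank (colspan M (J1 :|: c2 @: J)) <=
      p1 + \rank (colspan M (J1 :|: c2 @: J) *m lsubmx (rsubmx A)))%N.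
    have := rank_le_sum3 (colspan M (J1 :|: c2 @: J)) AB.
    rewrite zA mxrank0 addn0 => /leq_trans; apply.
    by rewrite leq_add2r rank_leq_col.
  have := rankbound_block c2i dX (tsub _ _ c2 _) zX hY (min1 _).
  rewrite cC1 rb1 -/S; lia.
(* Dually, the bound at [setT] is at most m, which gives q3 <= p3; equality makes [setT] a
   minimizer, so [J2] is everything and T is void. *)
- have := min2 setT; rewrite rb2 => /leq_trans /(_ rbT).
  have [e _|ne h] := eqVneq q3 p3; last by left; lia.
  have /ext [_ sT] : minimizer M setT.
    move=> K; apply: leq_trans (min2 K); apply: leq_trans rbT _; rewrite rb2; lia.
  have q30 : q3 = 0%N by apply/eqP; rewrite eq3 cards_eq0 -subset0 subCset setC0.
  by right; lia.
apply: FmR_intro => // J.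
have dX i : c3 i \notin J2 by have := cJ3 i; rewrite inE.
have hY : (\rank (colspan M (J2 :|: c3 @: J)) <=
    p1 + p2 + \rank (colspan M (J2 :|: c3 @: J) *m rsubmx (rsubmx A)))%N.
  have := rank_le_sum3 (colspan M (J2 :|: c3 @: J)) AB.
  rewrite addnA => /leq_trans; apply.
  by rewrite leq_add2r leq_add ?rank_leq_col.
have := rankbound_block c3i dX (tsub _ _ c3 _) zero2 hY (min1 _).
rewrite -eq3 rb1 -/T; lia.
Qed.

(** * Uniqueness *)

(** The transition matrix [D] is block triangular: [block_transition] applied to W clears its first
    upper block, and applied to S it clears that of the remaining corner [E]. The diagonal blocks
    are then invertible by determinants and, together with the column permutations, provide the
    three equivalences. *)
Lemma tri_block_unique (F : fieldType) k m n p1 p2 p3 q1 q2 q3 (M : aci F k m n)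
    (W W' : aci F k p1 q1) (S S' : aci F k p2 q2) (T T' : aci F k p3 q3)
    A B c A' B' c' :
  n = (q1 + (q2 + q3))%N ->
  tri_block M W S T A B c -> tri_block M W' S' T' A' B' c' ->
  FmR W -> (p1 <= q1)%N -> FmR S -> (p2 <= q2)%N ->
  [set c (lshift _ i) | i : 'I_q1] = [set c' (lshift _ i) | i : 'I_q1] ->
  [set c (rshift _ (rshift _ i)) | i : 'I_q3] =
    [set c' (rshift _ (rshift _ i)) | i : 'I_q3] ->
  [/\ aci_equiv W W', aci_equiv S S' & aci_equiv T T'].
Proof.
move=> en tri tri' fW le1 fS le2 eJ1 eJ3.
have rows := tri_block_rows tri; have rows' := tri_block_rows tri'.
case: tri tri' => AB BA ci _ [AB' BA' ci' _].
have eJ2 : [set c (rshift _ (lshift _ i)) | i : 'I_q2] =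
           [set c' (rshift _ (lshift _ i)) | i : 'I_q2].
  have compl d : injective d -> [set d (rshift q1 (lshift q3 i)) | i : 'I_q2] =
      ~: ([set d (lshift _ i) | i : 'I_q1] :|: [set d (rshift _ (rshift _ i)) | i : 'I_q3])
      :> {set 'I_n}.
    move=> di; apply/setP => j; rewrite !inE negb_or.
    apply/imsetP/andP => [[i _ ->]|[/imsetP n1 /imsetP n3]].
      split; apply/imsetP => [[i' _ /di]].
        by move/eqP; rewrite eq_rlshift.
      by move/rshift_inj/eqP; rewrite eq_lrshift.
    case: (inj_split_cases en di j) => [[i e]|[i e]|[i e]].
    - by case: n1; exists i.
    - by exists i.
    by case: n3; exists i.
  by rewrite !compl // eJ1 eJ3.
have [s1 hs1] : exists s : 'S_q1, forall i, c' (lshift _ i) = c (lshift _ (s i)).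
  by apply: same_image_perm eJ1 => i j => [/ci|/ci'] /lshift_inj.
have [s2 hs2] : exists s : 'S_q2, forall i,
    c' (rshift _ (lshift _ i)) = c (rshift _ (lshift _ (s i))).
  by apply: same_image_perm eJ2 => i j => [/ci|/ci'] /rshift_inj /lshift_inj.
have [s3 hs3] : exists s : 'S_q3, forall i,
    c' (rshift _ (rshift _ i)) = c (rshift _ (rshift _ (s i))).
  by apply: same_image_perm eJ3 => i j => [/ci|/ci'] /rshift_inj /rshift_inj.
pose D := B *m A'.
have rowD o j : row j (aci_tr M o) *m A' = row j (aci_tr M o) *m A *m D.
  by rewrite mulmxA -(mulmxA _ A B) AB mulmx1.
have uD : D \in unitmx.
  have : D *m (B' *m A) = 1%:M by rewrite mulmxA -(mulmxA B) AB' mulmx1.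
  by case/mulmx1_unit.
have [z1 tW] : ursubmx D = 0 /\
    forall o, aci_tr W' o = row_perm s1 (aci_tr W o *m ulsubmx D).
  apply: block_transition => // o i; case: (rows' o) => <- _ _.
  by rewrite rowD hs1; case: (rows o) => -> _ _.
pose E := drsubmx D.
have eD : D = block_mx (ulsubmx D) 0 (dlsubmx D) E by rewrite -{1}[D]submxK z1.
have mulD (x : 'rV_p1) y : row_mx x y *m D =
    row_mx (x *m ulsubmx D + y *m dlsubmx D) (y *m E).
  by rewrite {1}eD mul_row_block mulmx0 add0r.
have [z2 tS] : ursubmx E = 0 /\
    forall o, aci_tr S' o = row_perm s2 (aci_tr S o *m ulsubmx E).
  apply: block_transition => // o i; case: (rows' o) => _ /(_ i) [y e] _.
  case: (rows o) => _ /(_ (s2 i)) [y' e'] _; move: e.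
  by rewrite rowD hs2 e' mulD => /eq_row_mx [].
have tT o : aci_tr T' o = row_perm s3 (aci_tr T o *m drsubmx E).
  apply/row_matrixP => i; case: (rows' o) => _ _ /(_ i) [y [z e]].
  case: (rows o) => _ _ /(_ (s3 i)) [y' [z' e']]; move: e.
  rewrite rowD hs3 e' mulD => /eq_row_mx [_].
  rewrite -{1}[E]submxK z2 mul_row_block mulmx0 add0r => /eq_row_mx [_ <-].
  by rewrite -row_mul; apply/rowP => j; rewrite !mxE.
move: uD; rewrite unitmxE eD det_lblock unitrM -!unitmxE => /andP [u1].
rewrite unitmxE -[E]submxK z2 det_lblock unitrM -!unitmxE => /andP [u2 u3].
split; [exact: aci_equiv_intro u1 tW|exact: aci_equiv_intro u2 tS|].
exact: aci_equiv_intro u3 tT.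
Qed.

(** The decomposition yields minimizers [I1] and [~: I3] with [J1] <= [I1] <= [~: I3] <= [J2]. Since
    S is at least as large as the square block built from [J1] and [J2], the gap between the inner
    two sets is no smaller than that between the outer two, and the outer inclusions are
    equalities. *)
Lemma maxS_decomp_minimizers (F : fieldType) k m n p1 p2 p3 q1 q2 q3
    (M : aci F k m n) (W : aci F k p1 q1) (S : aci F k p2 q2) (T : aci F k p3 q3)
    (J1 J2 : {set 'I_n}) :
  isACI M -> minimizer M J1 -> minimizer M J2 ->
  (forall J, minimizer M J -> J1 \subset J /\ J \subset J2) ->
  maxS_decomp M W S T ->
  exists A B c, tri_block M W S T A B c /\
    [/\ J1 = [set c (lshift _ i) | i : 'I_q1],
        J2 = ~: [set c (rshift _ (rshift _ i)) | i : 'I_q3],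
        rankbound M J1 = (p1 + (q2 + q3))%N, q1 = #|J1| & q3 = #|~: J2|].
Proof.
move=> aciM min1 min2 ext [].
case/WST_decompP => [[em en [A [B [c tri]]]] [[w _ fW] [[sq _ fS] [t _ fT]]]] mx.
have [p1' [p2' [p3' [q1' [q2' [q3' [W' [S' [T' [dec e2']]]]]]]]]] :=
  exists_decomp aciM min1 min2 ext.
have le2 := mx _ _ _ _ _ _ _ _ _ dec.
have [||hm1 hm3 sJ e2 rb] := decomp_minimizers en tri _ sq _ fW fS fT.
- by case: w => [|[]]; lia.
- by case: t => [|[]]; lia.
move: hm1 hm3 sJ e2 rb; set I1 := [set _ | _ in _]; set I3 := [set _ | _ in _].
move=> hm1 hm3 sJ e2 rb.
have [s1 _] := ext _ hm1; have [_ s2] := ext _ hm3; have [_ s12] := ext _ min1.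
have e12 : (#|I1| <= #|J1|)%N /\ (#|J2| <= #|~: I3|)%N.
  have arith x y z u : (u - x <= p2)%N -> p2 = (z - y)%N -> (x <= y)%N ->
    (y <= z)%N -> (z <= u)%N -> (y <= x)%N /\ (u <= z)%N by lia.
  rewrite e2' cardsDS // in le2; rewrite -sq cardsDS // in e2.
  exact: arith le2 e2 (subset_leq_card s1) (subset_leq_card sJ) (subset_leq_card s2).
exists A, B, c; split=> //.
have eI1 : J1 = I1 by apply/eqP; rewrite eqEcard s1 e12.1.
have eI3 : J2 = ~: I3 by apply/eqP; rewrite eq_sym eqEcard s2 e12.2.
have ci : injective c by case: tri.
split; rewrite ?eI1 ?eI3 ?setCK // card_imset ?card_ord //.
  by move=> i j /ci /lshift_inj.
by move=> i j /ci /rshift_inj /rshift_inj.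
Qed.

Theorem theorem6p1 (F : fieldType) (k m n : nat) (M : aci F k m n) :
  isACI M ->
  (exists (p1 p2 p3 q1 q2 q3 : nat) (W : aci F k p1 q1) (S : aci F k p2 q2)
          (T : aci F k p3 q3), WST_decomp M W S T) /\
  (forall (p1 p2 p3 q1 q2 q3 : nat) (W : aci F k p1 q1) (S : aci F k p2 q2)
          (T : aci F k p3 q3)
          (p1' p2' p3' q1' q2' q3' : nat) (W' : aci F k p1' q1')
          (S' : aci F k p2' q2') (T' : aci F k p3' q3'),
     maxS_decomp M W S T -> maxS_decomp M W' S' T' ->
     [/\ aci_equiv W W', aci_equiv S S' & aci_equiv T T']).
Proof.
move=> aciM; have [J1 [J2 [min1 min2 ext]]] := extremal_minimizers M.
split.
  have [p1 [p2 [p3 [q1 [q2 [q3 [W [S [T [dec _]]]]]]]]]] :=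
    exists_decomp aciM min1 min2 ext.
  by exists p1, p2, p3, q1, q2, q3, W, S, T.
move=> p1 p2 p3 q1 q2 q3 W S T p1' p2' p3' q1' q2' q3' W' S' T' d d'.
have [A [B [c [tri [e1 e2 rb eq1 eq3]]]]] := maxS_decomp_minimizers aciM min1 min2 ext d.
have [A' [B' [c' [tri' [e1' e2' rb' eq1' eq3']]]]] :=
  maxS_decomp_minimizers aciM min1 min2 ext d'.
case: d => /WST_decompP [[em en _] [[w _ fW] [[sq _ fS] [t _ _]]]] _.
case: d' => /WST_decompP [[em' en' _] [_ [[sq' _ _] _]]] _.
(* The extremal minimizers fix q1 and q3, and n then fixes q2. The value of [rankbound] at [J1]
   fixes p1, squareness fixes p2, and m fixes p3. *)
have eqq1 : q1 = q1' by rewrite eq1 -eq1'.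
have eqq3 : q3 = q3' by rewrite eq3 -eq3'.
have eqq2 : q2 = q2' by move: en'; rewrite {1}en; lia.
have ep1 : p1 = p1' by move: rb'; rewrite rb; lia.
have ep2 : p2 = p2' by rewrite sq sq'.
have ep3 : p3 = p3' by lia.
clear eq1 eq1' eq3 eq3' sq'; subst q1' q2' q3' p1' p2' p3'.
have le1 : (p1 <= q1)%N by case: w => [|[]]; lia.
have le2 : (p2 <= q2)%N by rewrite sq.
apply: (tri_block_unique en tri tri' fW le1 fS le2); first by rewrite -e1.
by apply: setC_inj; rewrite -e2.
Qed.
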